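(* Let $k$ be a field. (1) There exists a closed curve $C\subset\mathbb{A}^2$, isomorphic to $\mathbb{A}^1\setminus\{0\}$, such that there are infinitely many equivalence classes of open embeddings $\mathbb{A}^2\setminus C\hookrightarrow\mathbb{A}^2$. Moreover, the set of equivalence classes of closed curves $C\subset \mathbb{A}^2$ with this property is infinite. (2) For every integer $n\ge1$, there exist pairwise non-equivalent closed curves $C_1,\dots,C_n\subset\mathbb{A}^2$, all isomorphic to $\mathbb{A}^1\setminus\{0\}$, such that the surfaces $\mathbb{A}^2\setminus C_1,\dots,\mathbb{A}^2\setminus C_n$ are all isomorphic. Moreover, if $\operatorname{char}(k)=0$, there exists an infinite sequence $(C_i)_{i\in\mathbb{N}}$ of pairwise non-equivalent closed curves $C_i\subset\mathbb{A}^2$ such that the surfaces $\mathbb{A}^2\setminus C_i$, $i\in\mathbb{N}$, are all isomorphic. (3) For each polynomial $f\in k[t]$ of degree $\ge1$, there exist two non-equivalent closed curves $C,D\subset\mathbb{A}^2$, both isomorphic to $\operatorname{Spec}(k[t,\frac1f])$, such that $\mathbb{A}^2\setminus C$ and $\mathbb{A}^2\setminus D$ are isomorphic. Moreover, the set of equivalence classes of the curves $C$ appearing in such pairs $(C,D)$ is infinite.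
   Context: All varieties and morphisms are over $k$. Two closed curves in $\mathbb{A}^2$ are equivalent if some automorphism of $\mathbb{A}^2$ maps one onto the other. Two open embeddings $\varphi_1,\varphi_2\colon\mathbb{A}^2\setminus C\hookrightarrow\mathbb{A}^2$ are equivalent if $\varphi_2=\alpha\circ\varphi_1$ for some automorphism $\alpha$ of $\mathbb{A}^2$. *)

(* Defs.v *)
(* k[x,y] = {mpoly k[2]}, k(x,y) = {fraction {mpoly k[2]}},
   k[t] = {poly k}, k(t) = {fraction {poly k}}.  All affine schemes involved
   are spectra of subrings of these fraction fields. *)
From HB Require Import structures.
From mathcomp Require Import all_boot all_order all_algebra.
From mathcomp Require Import fraction.
From mathcomp Require Import mpoly.
Set Implicit Arguments.
Unset Strict Implicit.
Unset Printing Implicit Defensive.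
Import Order.TTheory GRing.Theory Num.Theory.
Local Open Scope ring_scope.
Local Notation "x %:F" := (@FracField.tofrac _ x) : ring_scope.

Definition P2 (k : fieldType) := {mpoly k[2]}.
Definition K2 (k : fieldType) := {fraction {mpoly k[2]}}.
Definition K1 (k : fieldType) := {fraction {poly k}}.

Definition ordX (k : fieldType) : 'I_2 := ord0.
Definition ordY (k : fieldType) : 'I_2 := @Ordinal 2 1 isT.
Definition pX (k : fieldType) : {mpoly k[2]} := 'X_(ordX k).
Definition pY (k : fieldType) : {mpoly k[2]} := 'X_(ordY k).

Definition ev2 (k : fieldType) (S : nzRingType) (e : k -> S) (u v : S)
  (p : {mpoly k[2]}) : S :=
  mmap e (fun i : 'I_2 => if i == ordX k then u else v) p.

Definition subst2 (k : fieldType) (a b p : {mpoly k[2]}) : {mpoly k[2]} :=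
  ev2 (fun c : k => c%:MP) a b p.

Definition constK2 (k : fieldType) (c : k) : {fraction {mpoly k[2]}} :=
  (c%:MP)%:F.

Definition evK (k : fieldType) (u v : {fraction {mpoly k[2]}})
  (p : {mpoly k[2]}) : {fraction {mpoly k[2]}} :=
  ev2 (@constK2 k) u v p.

(* irreducible polynomial: a closed curve in A^2 is V(f), f irreducible *)
Definition mirreducible (k : fieldType) (f : {mpoly k[2]}) : Prop :=
  [/\ f != 0, f \isn't a GRing.unit &
      forall a b : {mpoly k[2]}, f = a * b ->
        a \is a GRing.unit \/ b \is a GRing.unit].

Definition closed_curve (k : fieldType) (f : {mpoly k[2]}) : Prop :=
  mirreducible f.

Definition A2_aut (k : fieldType) (a b : {mpoly k[2]}) : Prop :=
  exists c d : {mpoly k[2]},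
    [/\ subst2 a b c = pX k, subst2 a b d = pY k,
        subst2 c d a = pX k & subst2 c d b = pY k].

(* two closed curves V(f), V(g) are equivalent: some automorphism alpha of
   A^2 maps V(f) onto V(g), i.e. alpha^*(g) generates the ideal (f) *)
Definition curve_equiv (k : fieldType) (f g : {mpoly k[2]}) : Prop :=
  exists a b : {mpoly k[2]}, A2_aut a b /\
    exists c : k, c != 0 /\ subst2 a b g = c%:MP * f.

(* the coordinate ring k[x,y][1/f] of A^2 \ V(f), as a subring of k(x,y) *)
Definition locK2 (k : fieldType) (f : {mpoly k[2]}) :
  {fraction {mpoly k[2]}} -> Prop :=
  fun r => exists (p : {mpoly k[2]}) (n : nat), r = p%:F / (f%:F) ^+ n.

Definition locK1 (k : fieldType) (q : {poly k}) : {fraction {poly k}} -> Prop :=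
  fun r => exists (p : {poly k}) (n : nat), r = p%:F / (q%:F) ^+ n.

(* the closed curve V(f) is isomorphic to Spec k[t][1/q]:
   there is a k-algebra morphism psi : k[x,y] -> k[t][1/q] (x |-> a, y |-> b)
   which is surjective with kernel (f), i.e. k[x,y]/(f) ~= k[t][1/q]. *)
Definition curve_iso_loc (k : fieldType) (f : {mpoly k[2]}) (q : {poly k}) :
  Prop :=
  exists a b : {fraction {poly k}},
    [/\ locK1 q a, locK1 q b,
        (forall r, locK1 q r -> exists p : {mpoly k[2]},
             ev2 (fun c : k => (c%:P)%:F) a b p = r) &
        (forall p : {mpoly k[2]},
             ev2 (fun c : k => (c%:P)%:F) a b p = 0 <-> exists s, p = s * f)].

Definition subalg_iso (k : fieldType) (A B : {fraction {mpoly k[2]}} -> Prop) :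
  Prop :=
  exists sigma : {fraction {mpoly k[2]}} -> {fraction {mpoly k[2]}},
    [/\ (forall x, A x -> B (sigma x)),
        (forall x y, A x -> A y ->
           sigma (x + y) = sigma x + sigma y /\ sigma (x * y) = sigma x * sigma y),
        (forall c : k, sigma (constK2 c) = constK2 c),
        (forall x y, A x -> A y -> sigma x = sigma y -> x = y) &
        (forall z, B z -> (exists2 x, A x & sigma x = z))].

Definition compl_iso (k : fieldType) (f g : {mpoly k[2]}) : Prop :=
  subalg_iso (locK2 f) (locK2 g).

(* A morphism A^2 \ V(f) -> A^2 is a k-algebra map k[x,y] -> k[x,y][1/f],
   i.e. a pair (u,v) of elements of k[x,y][1/f]; its comorphism is evK u v.
   It is an open immersion iff there are h_1..h_m in k[x,y] whose pullbacks
   generate the unit ideal of k[x,y][1/f] and such that each induced map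
   k[x,y][1/h_i] -> k[x,y][1/f][1/phi(h_i)], p/h_i^n |-> phi(p)/phi(h_i)^n,
   is an isomorphism (an isomorphism being local on the target).  When
   phi(h_i) <> 0 both rings are subrings of k(x,y) and this map is
   computed there; when phi(h_i) = 0 the target is the zero ring, so the map
   is an isomorphism iff h_i = 0. *)
Definition open_emb (k : fieldType) (f : {mpoly k[2]})
  (u v : {fraction {mpoly k[2]}}) : Prop :=
  [/\ locK2 f u, locK2 f v &
    exists hs : seq ({mpoly k[2]} * {fraction {mpoly k[2]}}),
      [/\ (forall hb, hb \in hs -> locK2 f hb.2),
          \sum_(hb <- hs) hb.2 * evK u v hb.1 = 1 &
          (forall hb, hb \in hs ->
             hb.1 = 0 \/
             [/\ evK u v hb.1 != 0,
                 (forall (p : {mpoly k[2]}) (n : nat),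
                    evK u v p / (evK u v hb.1) ^+ n = 0 ->
                    p%:F / (hb.1%:F) ^+ n = 0) &
                 (forall (r : {fraction {mpoly k[2]}}) (m : nat), locK2 f r ->
                    exists (p : {mpoly k[2]}) (n : nat),
                      r / (evK u v hb.1) ^+ m =
                      evK u v p / (evK u v hb.1) ^+ n)])]].

(* equivalence of open embeddings: phi2 = alpha o phi1 for alpha in Aut(A^2);
   on comorphisms: phi2^*(x) = phi1^*(alpha^*(x)), phi2^*(y) = phi1^*(alpha^*(y)) *)
Definition emb_equiv (k : fieldType) (u1 v1 u2 v2 : {fraction {mpoly k[2]}}) :
  Prop :=
  exists a b : {mpoly k[2]}, A2_aut a b /\ u2 = evK u1 v1 a /\ v2 = evK u1 v1 b.

Definition inf_many_embs (k : fieldType) (f : {mpoly k[2]}) : Prop :=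
  exists e : nat -> {fraction {mpoly k[2]}} * {fraction {mpoly k[2]}},
    (forall i, open_emb f (e i).1 (e i).2) /\
    (forall i j, i <> j -> ~ emb_equiv (e i).1 (e i).2 (e j).1 (e j).2).

(* 1 <= deg q ; Spec k[t,1/t] = A^1 \ {0} *)
Definition tpoly (k : fieldType) : {poly k} := 'X.

(* Main.v *)
Require Import Defs.
From HB Require Import structures.
From mathcomp Require Import all_boot all_order all_algebra.
From mathcomp Require Import fraction.
From mathcomp Require Import mpoly.
From mathcomp Require Import ring zify.
Set Implicit Arguments.
Unset Strict Implicit.
Unset Printing Implicit Defensive.
Import Order.TTheory GRing.Theory Num.Theory.
Local Open Scope ring_scope.
Local Notation "x %:F" := (@FracField.tofrac _ x) : ring_scope.

(** All curves are graphs a(x) y + b(x) = 0 with a and b coprime, which are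
    isomorphic to Spec k[t, 1/a] through x |-> t, y |-> - b/a.

    Over the generic point of the x-line, the complement of such a graph f = 0
    is the punctured line with coordinate f, and its automorphisms
    f |-> c f^(+-1) are made polynomial in x and y by correcting y:
    - for f = x^m y + 1, (x, y) |-> (x f^n, y / f^(m n)) is an automorphism of
      the complement, and these are pairwise inequivalent as embeddings;
    - for f = x^m y + 1 + x, the substitution x' = x f^j yields the graphs
      x^m y + b_j(x), where b_j(x (1 + x)^j) = 1 + x modulo x^m;
    - if b b' = 1 modulo a, then 1/f identifies the complements of a y + b and
      a y + b'; this is applied to Q^3, 1 + Q and 1 - Q + Q^2, Q a power of q.

    When deg a >= 2 and deg b < deg a, comparing y-degrees shows that an
    automorphism of the plane mapping one graph to another acts on x by an
    affine map, which distinguishes the curves. *)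

(** * Evaluation morphisms on k[x,y] *)

HB.instance Definition _ (k : fieldType) :=
  GRing.RMorphism.copy (@constK2 k) (@FracField.tofrac _ \o @mpolyC 2 k).

Definition constK1 (k : fieldType) (c : k) : {fraction {poly k}} := (c%:P)%:F.

HB.instance Definition _ (k : fieldType) :=
  GRing.RMorphism.copy (@constK1 k) (@FracField.tofrac _ \o @polyC k).

Section Evaluation.
Variables (k : fieldType) (S : comNzRingType) (e : {rmorphism k -> S}).
Implicit Types (u v : S) (p : {mpoly k[2]}).

HB.instance Definition _ u v := GRing.RMorphism.copy (ev2 e u v)
  (mmap e (fun i : 'I_2 => if i == ordX k then u else v)).

Lemma ev2C u v c : ev2 e u v c%:MP = e c.
Proof. exact: mmapC. Qed.

Lemma ev2X u v : ev2 e u v (pX k) = u.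
Proof. by rewrite /ev2 mmapX mmap1U. Qed.

Lemma ev2Y u v : ev2 e u v (pY k) = v.
Proof. by rewrite /ev2 mmapX mmap1U. Qed.

End Evaluation.

HB.instance Definition _ (k : fieldType) (u v : {fraction {mpoly k[2]}}) :=
  GRing.RMorphism.copy (evK u v) (ev2 (@constK2 k) u v).

HB.instance Definition _ (k : fieldType) (a b : {mpoly k[2]}) :=
  GRing.RMorphism.copy (subst2 a b) (ev2 (@mpolyC 2 k) a b).

(** * Generators of k[x,y] and the embedding of k[x] *)

Section Coordinates.
Variable k : fieldType.
Implicit Types p q : {mpoly k[2]}.

Lemma mpoly2_ind (P : {mpoly k[2]} -> Prop) :
  (forall c, P c%:MP) -> P (pX k) -> P (pY k) ->
  (forall p q, P p -> P q -> P (p + q)) ->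
  (forall p q, P p -> P q -> P (p * q)) ->
  forall p, P p.
Proof.
move=> PC PX PY PD PM; elim/mpolyind=> [|c m p _ _ Pp].
  by rewrite -mpolyC0; apply: PC.
apply: (PD) => //; rewrite -mul_mpolyC; apply: (PM) => //.
rewrite mpolyXE_id; apply: (big_ind P) => [||i _]; first by rewrite -mpolyC1.
  exact: PM.
elim: (m i) => [|n IHn]; first by rewrite expr0 -mpolyC1; apply: PC.
rewrite exprS; apply: PM => //.
case: i {IHn} => [[|[|//]] lt_i].
  by rewrite (_ : Ordinal lt_i = ordX k) //; apply: val_inj.
by rewrite (_ : Ordinal lt_i = ordY k) //; apply: val_inj.
Qed.

(** Serves to rewrite a composite of substitutions as a single evaluation. *)
Lemma ev2_unique (S : comNzRingType) (e : {rmorphism k -> S})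
    (phi : {rmorphism {mpoly k[2]} -> S}) u v :
  (forall c, phi c%:MP = e c) -> phi (pX k) = u -> phi (pY k) = v ->
  phi =1 ev2 e u v.
Proof.
move=> phiC <- <-; elim/mpoly2_ind=> [c|||p q IHp IHq|p q IHp IHq].
- by rewrite ev2C.
- by rewrite ev2X.
- by rewrite ev2Y.
- by rewrite !rmorphD IHp IHq.
- by rewrite !rmorphM IHp IHq.
Qed.

Definition inX (p : {poly k}) : {mpoly k[2]} :=
  (map_poly (@mpolyC 2 k) p).[pX k].

HB.instance Definition _ :=
  GRing.RMorphism.copy inX (horner_eval (pX k) \o map_poly (@mpolyC 2 k)).

Lemma inXX : inX 'X = pX k.
Proof. by rewrite /inX map_polyX hornerX. Qed.

Lemma inXC c : inX c%:P = c%:MP.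
Proof. by rewrite /inX map_polyC hornerC. Qed.

Lemma ev2_inX (S : comNzRingType) (e : {rmorphism k -> S}) u v
    (p : {poly k}) :
  ev2 e u v (inX p) = (map_poly e p).[u].
Proof.
rewrite /inX -[RHS](congr1 (horner _) (ev2X e u v)).
rewrite -[LHS]/((ev2 e u v) _) -horner_map -map_poly_comp; congr _.[_].
by apply: eq_map_poly => c /=; rewrite ev2C.
Qed.

Lemma evK_inX u v (p : {poly k}) : evK u v (inX p) = (map_poly (@constK2 k) p).[u].
Proof. exact: ev2_inX. Qed.

Lemma evKX u v : evK u v (pX k) = u. Proof. exact: ev2X. Qed.
Lemma evKY u v : evK u v (pY k) = v. Proof. exact: ev2Y. Qed.
Lemma evKC u v (c : k) : evK u v c%:MP = constK2 c. Proof. exact: ev2C. Qed.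

Lemma tofrac_inX (p : {poly k}) : (inX p)%:F = (map_poly (@constK2 k) p).[(pX k)%:F].
Proof.
rewrite /inX -horner_map -map_poly_comp; congr _.[_].
Qed.

Lemma horner_tofrac_inX (p : {poly k}) (w : {mpoly k[2]}) :
  (map_poly (@constK2 k) p).[w%:F] = ((map_poly (@mpolyC 2 k) p).[w])%:F.
Proof. by rewrite -horner_map -map_poly_comp. Qed.

End Coordinates.

(** * Extension of injective morphisms to fraction fields *)

Section FractionMorphism.
Variables (R : idomainType) (F : fieldType) (phi : {rmorphism R -> F}).
Hypothesis phi_inj : injective phi.

Let phi_neq0 (z : R) : z != 0 -> phi z != 0.
Proof. by apply: contra_neq => z0; apply: phi_inj; rewrite z0 rmorph0. Qed.

(** Read off on the chosen representative of [r]; [frac_extE] shows that the choice does not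
    matter. *)
Definition frac_ext of injective phi := fun (r : {fraction R}) =>
  let x := repr r in phi \n_x / phi \d_x.

Lemma frac_reprE (r : {fraction R}) :
  r = (\n_(repr r))%:F / (\d_(repr r))%:F.
Proof.
have d0 := denom_ratioP (repr r).
rewrite -[LHS]reprK.
set n := \n_ _; set d := \d_ _.
have tofracE (z : R) : z%:F = \pi_({fraction R})%qT (Ratio z 1).
  by rewrite /FracField.tofrac; unlock.
rewrite !tofracE; rewrite -[_^-1]/(FracField.inv _) -[RHS]/(FracField.mul _ _).
rewrite -FracField.pi_inv -FracField.pi_mul.
apply/eqP; rewrite FracField.equivf_def /FracField.mulf /FracField.invf.
by rewrite !numden_Ratio ?oner_neq0 ?mulr1 ?mul1r // mulrC.
Qed.

Lemma frac_extE p q : q != 0 -> frac_ext phi_inj (p%:F / q%:F) = phi p / phi q.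
Proof.
move=> q0; rewrite /frac_ext; set x := repr _.
have d0 : \d_x != 0 := denom_ratioP x.
have : p%:F / q%:F = (\n_x)%:F / (\d_x)%:F by rewrite -frac_reprE.
move/eqP; rewrite eqr_div ?tofrac_eq0 // -!rmorphM /= tofrac_eq => /eqP E.
by apply/eqP; rewrite eqr_div ?phi_neq0 // -!rmorphM E mulrC.
Qed.

Lemma frac_ext_tofrac p : frac_ext phi_inj p%:F = phi p.
Proof. by rewrite -[p%:F]divr1 -tofrac1 frac_extE ?oner_neq0 // rmorph1 divr1. Qed.

Lemma frac_ext_zmod_morphism : zmod_morphism (frac_ext phi_inj).
Proof.
move=> x y; have dx := denom_ratioP (repr x); have dy := denom_ratioP (repr y).
rewrite [in LHS](frac_reprE x) [in LHS](frac_reprE y).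
rewrite -mulNr addf_div ?tofrac_eq0 // -!rmorphN -!rmorphM -rmorphD /=.
rewrite frac_extE ?mulf_neq0 // !(rmorphD, rmorphM, rmorphN) /=.
by rewrite -addf_div ?phi_neq0 // mulNr.
Qed.

Lemma frac_ext_monoid_morphism : monoid_morphism (frac_ext phi_inj).
Proof.
split=> [|x y]; first by rewrite -tofrac1 frac_ext_tofrac rmorph1.
have dx := denom_ratioP (repr x); have dy := denom_ratioP (repr y).
rewrite [in LHS](frac_reprE x) [in LHS](frac_reprE y).
by rewrite mulf_div -!rmorphM /= frac_extE ?mulf_neq0 // !rmorphM -mulf_div.
Qed.

HB.instance Definition _ := GRing.isZmodMorphism.Build {fraction R} F
  (frac_ext phi_inj) frac_ext_zmod_morphism.
HB.instance Definition _ := GRing.isMonoidMorphism.Build {fraction R} F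
  (frac_ext phi_inj) frac_ext_monoid_morphism.

Lemma frac_ext_div p q : frac_ext phi_inj (p%:F / q%:F) = phi p / phi q.
Proof.
have [->|] := eqVneq q 0; last exact: frac_extE.
(* For q = 0 both sides vanish, by the convention 1/0 = 0. *)
by rewrite tofrac0 rmorph0 !invr0 !mulr0 -tofrac0 frac_ext_tofrac rmorph0.
Qed.

Lemma frac_ext_divX p q n :
  frac_ext phi_inj (p%:F / q%:F ^+ n) = phi p / phi q ^+ n.
Proof. by rewrite -tofracXn frac_ext_div rmorphXn. Qed.

End FractionMorphism.

(** * The rings k[x,y][1/f] *)

Section Localization.
Variables (k : fieldType) (f : {mpoly k[2]}).

Lemma locK2_tofrac p : locK2 f p%:F.
Proof. by exists p, 0; rewrite expr0 divr1. Qed.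

Lemma locK2M x y : locK2 f x -> locK2 f y -> locK2 f (x * y).
Proof.
move=> [p [n ->]] [q [m ->]]; exists (p * q), (n + m)%N.
by rewrite mulf_div -exprD -rmorphM.
Qed.

Lemma locK2X x n : locK2 f x -> locK2 f (x ^+ n).
Proof.
move=> fx; elim: n => [|n IHn]; first by rewrite expr0 -tofrac1; apply: locK2_tofrac.
by rewrite exprS; apply: locK2M.
Qed.

End Localization.

(** * Isomorphisms of complements from mutually inverse pairs *)

Section MutuallyInverse.
Variable k : fieldType.
Implicit Types (f g p : {mpoly k[2]}) (u v x y : {fraction {mpoly k[2]}}).

(* For u, v in k[x,y][1/g], the pair (u', v') maps A^2 \ V(f) into A^2 \ V(g)
   and (u, v) o (u', v') is the inclusion of A^2 \ V(f) in A^2. *)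
Definition left_inverse_pair f g u v u' v' :=
  [/\ exists p n, u = p%:F / g%:F ^+ n /\
        evK u' v' p = (pX k)%:F * evK u' v' g ^+ n,
      exists p n, v = p%:F / g%:F ^+ n /\
        evK u' v' p = (pY k)%:F * evK u' v' g ^+ n,
      evK u' v' g != 0
    & locK2 f (evK u' v' g)^-1].

Definition inverse_pairs f g u v u' v' :=
  left_inverse_pair f g u v u' v' /\ left_inverse_pair g f u' v' u v.

Lemma inverse_pairs_sym f g u v u' v' :
  inverse_pairs f g u v u' v' -> inverse_pairs g f u' v' u v.
Proof. by case. Qed.

(** Fractions over powers of g are stable under sums and products, so the two relations on the
    coordinates propagate to every polynomial p. *)
Lemma left_inverse_pair_lift f g u v u' v' :
  left_inverse_pair f g u v u' v' -> forall p, exists q n,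
    evK u v p = q%:F / g%:F ^+ n /\ evK u' v' q = p%:F * evK u' v' g ^+ n.
Proof.
case=> ux vy g0 _; have gF0 : g%:F != 0.
  by rewrite tofrac_eq0; apply: contra_neq g0 => ->; rewrite rmorph0.
elim/mpoly2_ind => [c|||p q [P [n [Ep EP]]] [Q [m [Eq EQ]]]
                       |p q [P [n [Ep EP]]] [Q [m [Eq EQ]]]].
- by exists c%:MP, 0; rewrite !evKC !expr0 divr1 mulr1.
- by rewrite evKX.
- by rewrite evKY.
- exists (P * g ^+ m + Q * g ^+ n), (n + m)%N.
  rewrite !(rmorphD, rmorphM, rmorphXn) /= Ep Eq EP EQ !exprD; split; last by ring.
  by rewrite addf_div ?expf_neq0.
- exists (P * Q), (n + m)%N.
  rewrite !(rmorphM, rmorphXn) /= Ep Eq EP EQ !exprD; split; last by ring.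
  by rewrite mulf_div.
Qed.

(** If p is sent to 0, its numerator q over a power of g is 0, and applying (u', v') to q gives p
    times a nonzero factor. *)
Lemma left_inverse_pair_inj f g u v u' v' :
  left_inverse_pair f g u v u' v' -> injective (evK u v).
Proof.
move=> L; have g0 : evK u' v' g != 0 by case: L.
apply: raddf_inj => p p0; have [q [n [Ep Eq]]] := left_inverse_pair_lift L p.
have gF0 : g%:F != 0.
  by rewrite tofrac_eq0; apply: contra_neq g0 => ->; rewrite rmorph0.
move/esym/eqP: Ep; rewrite p0 mulf_eq0 invr_eq0 expf_eq0 (negPf gF0) andbF orbF.
rewrite tofrac_eq0 => /eqP q0; move/esym/eqP: Eq; rewrite q0 rmorph0.
by rewrite mulf_eq0 expf_eq0 (negPf g0) andbF orbF tofrac_eq0 => /eqP.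
Qed.

Lemma frac_ext_evK f g u v u' v' (L : left_inverse_pair f g u v u' v')
    (inj' : injective (evK u' v')) p :
  frac_ext inj' (evK u v p) = p%:F.
Proof.
have [q [n [-> Eq]]] := left_inverse_pair_lift L p.
by case: L => _ _ g0 _; rewrite frac_ext_divX /= Eq (mulfK (expf_neq0 n g0)).
Qed.

Lemma frac_extK f g u v u' v' (L : left_inverse_pair f g u v u' v')
    (inj : injective (evK u v)) (inj' : injective (evK u' v')) :
  cancel (frac_ext inj) (frac_ext inj').
Proof.
move=> x; have := frac_reprE x; move: (\n_ _) (\d_ _) => p q ->.
by rewrite frac_ext_div (fmorph_div (frac_ext inj')) /= !(frac_ext_evK L).
Qed.

(** The inverse of f goes to the inverse of [evK u v f], which the opposite half of the pair places
    in k[x,y][1/g]. *)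
Lemma frac_ext_loc f g u v u' v' (I : inverse_pairs f g u v u' v')
    (inj : injective (evK u v)) x :
  locK2 f x -> locK2 g (frac_ext inj x).
Proof.
case: I => L [_ _ _ gV] [p [n ->]].
rewrite frac_ext_divX /= -exprVn.
apply: locK2M; last exact: locK2X.
by have [q [m [-> _]]] := left_inverse_pair_lift L p; exists q, m.
Qed.

Lemma inverse_pairs_compl_iso f g u v u' v' :
  inverse_pairs f g u v u' v' -> compl_iso f g.
Proof.
move=> I; have [L L'] := I.
have inj := left_inverse_pair_inj L; have inj' := left_inverse_pair_inj L'.
exists (frac_ext inj); split=> [x|x y _ _|c|x y _ _|z gz].
- exact: frac_ext_loc I _ _.
- by rewrite rmorphD rmorphM.
- by rewrite [LHS]frac_ext_tofrac /= evKC.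
- exact: fmorph_inj.
- exists (frac_ext inj' z); last exact: frac_extK L' _ _ _.
  exact: frac_ext_loc (inverse_pairs_sym I) _ _ gz.
Qed.

Lemma inverse_pairs_open_emb f g u v u' v' :
  inverse_pairs f g u v u' v' -> open_emb g u v.
Proof.
move=> I; have [L L'] := I.
have inj := left_inverse_pair_inj L; have inj' := left_inverse_pair_inj L'.
case: (L) => [[p [n [Eu _]]] [q [m [Ev _]]] _ _]; case: (L') => [_ _ f0 fV].
split; first by exists p, n.
  by exists q, m.
(* One chart suffices: the image of the embedding is the complement of f = 0, and the pullback of f
   is already invertible. *)
exists [:: (f, (evK u v f)^-1)]; split=> [hb||hb].
- by rewrite inE => /eqP ->.
- by rewrite big_seq1 mulVf.
- rewrite inE => /eqP -> /=; right; split=> // [r l|r l gr].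
    move/eqP; rewrite mulf_eq0 invr_eq0 expf_eq0 (negPf f0) andbF orbF => /eqP r0.
    by rewrite (inj r 0) ?rmorph0 ?mul0r.
  have [s [N Es]] := frac_ext_loc (inverse_pairs_sym I) inj' gr.
  exists s, (N + l)%N; rewrite -(frac_extK L' inj' inj r) Es.
  by rewrite frac_ext_divX exprD invfM mulrA.
Qed.

Lemma compl_iso_trans f g h : compl_iso f g -> compl_iso g h -> compl_iso f h.
Proof.
move=> [s [s1 s2 s3 s4 s5]] [t [t1 t2 t3 t4 t5]].
exists (t \o s); split=> /= [x fx|x y fx fy|c|x y fx fy E|z hz].
- exact/t1/s1.
- by have [-> ->] := s2 x y fx fy; apply: t2; apply: s1.
- by rewrite s3.
- by apply: s4 => //; apply: t4 => //; apply: s1.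
- by have [y gy <-] := t5 z hz; have [x fx <-] := s5 y gy; exists x.
Qed.

End MutuallyInverse.

(** * Graphs a(x) y + b(x) = 0 and their coordinate rings *)

Section Graphs.
Variable k : fieldType.
Implicit Types a b p q u v : {poly k}.

Definition graph a b : {mpoly k[2]} := inX a * pY k + inX b.

Lemma map_constK1_X p : (map_poly (@constK1 k) p).['X%:F] = p%:F.
Proof.
have -> : map_poly (@constK1 k) p =
    map_poly (@FracField.tofrac _) (map_poly polyC p) by rewrite -map_poly_comp.
by rewrite horner_map -[_.['X]]/(p \Po 'X) comp_polyXr.
Qed.

Lemma graph_root a b : a != 0 ->
  ev2 (@constK1 k) 'X%:F (- b%:F / a%:F) (graph a b) = 0.
Proof.
move=> a0; rewrite rmorphD rmorphM /= !ev2_inX !map_constK1_X ev2Y mulrC mulfVK.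
  exact: addNr.
by rewrite tofrac_eq0.
Qed.

(* Modulo f, the element w := v - u y is an inverse of a(x), so that every
   polynomial is congruent to some r(x) w^n. *)
Lemma graph_normal_form a b u v : u * b + v * a = 1 ->
  forall p : {mpoly k[2]}, exists (s : {mpoly k[2]}) (r : {poly k}) (n : nat),
    p = s * graph a b + inX r * (inX v - inX u * pY k) ^+ n.
Proof.
move=> /(congr1 (@inX k)); rewrite rmorphD !rmorphM rmorph1 /= => uv.
set w := inX v - inX u * pY k; set f := graph a b.
have aw : inX a * w = 1 - inX u * f by rewrite -uv /w /f /graph; ring.
(* Powers of a(x) w are 1 modulo f, so two terms r w^n and r' w^n' can be brought to the common
   exponent n + n'. *)
have awX n : exists s, (inX a * w) ^+ n = 1 + s * f.
  elim: n => [|n [s E]]; first by exists 0; rewrite expr0 mul0r addr0.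
  by exists (s - inX u - inX u * s * f); rewrite exprS E aw; ring.
elim/mpoly2_ind => [c|||p q [s [r [n ->]]] [s' [r' [n' ->]]]
                       |p q [s [r [n ->]]] [s' [r' [n' ->]]]].
- by exists 0, c%:P, 0%N; rewrite inXC mul0r add0r mulr1.
- by exists 0, 'X, 0%N; rewrite inXX mul0r add0r mulr1.
(* From a w + u f = 1 and a y = f - b, y is congruent to - b w. *)
- exists (w + pY k * inX u), (- b), 1%N; rewrite rmorphN expr1.
  transitivity (pY k * (inX a * w + inX u * f)); first by rewrite aw; ring.
  by rewrite /f /graph; ring.
- have [t E] := awX n; have [t' E'] := awX n'.
  exists (s + s' - inX r * w ^+ n * t' - inX r' * w ^+ n' * t).
  exists (r * a ^+ n' + r' * a ^+ n), (n + n')%N.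
  rewrite rmorphD !rmorphM !rmorphXn /=.
  have -> : (inX r * inX a ^+ n' + inX r' * inX a ^+ n) * w ^+ (n + n') =
      inX r * w ^+ n * (inX a * w) ^+ n' + inX r' * w ^+ n' * (inX a * w) ^+ n.
    by rewrite !exprMn exprD; ring.
  by rewrite E E'; ring.
- exists (s * (s' * f + inX r' * w ^+ n') + inX r * w ^+ n * s'), (r * r'), (n + n')%N.
  by rewrite !rmorphM /= exprD; ring.
Qed.

(** Under x |-> t, y |-> - b/a, the element v - u y becomes 1/a. As a is a positive power of q, this
    yields all of k[t, 1/q], and the normal form modulo f determines the kernel. *)
Lemma graph_iso_loc q N a b u v :
  q != 0 -> a = q ^+ N.+1 -> u * b + v * a = 1 -> curve_iso_loc (graph a b) q.
Proof.
move=> q0 aq uv; have a0 : a != 0 by rewrite aq expf_neq0.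
have aF0 : a%:F != 0 by rewrite tofrac_eq0.
exists 'X%:F, (- b%:F / a%:F).
set e := (fun c : k => _); rewrite -/(@constK1 k) in e *.
have eX p : ev2 e 'X%:F (- b%:F / a%:F) (inX p) = p%:F.
  by rewrite (ev2_inX (@constK1 k)) map_constK1_X.
have ew : ev2 e 'X%:F (- b%:F / a%:F) (inX v - inX u * pY k) = (a%:F)^-1.
  rewrite rmorphB rmorphM /= !eX ev2Y; apply: (mulIf aF0).
  rewrite mulVf // mulrBl -mulrA mulfVK // mulrN opprK -!rmorphM -rmorphD addrC.
  by rewrite uv rmorph1.
have ef : ev2 e 'X%:F (- b%:F / a%:F) (graph a b) = 0 := graph_root b a0.
split.
- by exists 'X, 0%N; rewrite divr1.
- by exists (- b), N.+1; rewrite aq rmorphN rmorphXn.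
- move=> r [p [n ->]].
  (* Since a^n = q^(N n) q^n, the fraction p / q^n equals p q^(N n) / a^n. *)
  exists (inX (p * q ^+ (N * n)) * (inX v - inX u * pY k) ^+ n).
  rewrite rmorphM rmorphXn /= eX ew aq rmorphM !rmorphXn /= exprVn -exprM mulSn.
  have qF0 : q%:F != 0 by rewrite tofrac_eq0.
  by rewrite exprD invfM mulrACA mulfV ?expf_neq0 // mulr1.
- move=> p; split=> [|[s ->]]; last by rewrite rmorphM /= ef mulr0.
  (* The remainder r(x) w^n evaluates to r / a^n, which is zero only for r = 0. *)
  have [s [r [n ->]]] := graph_normal_form uv p.
  rewrite rmorphD !rmorphM rmorphXn /= ef ew eX mulr0 add0r => /eqP.
  rewrite mulf_eq0 expf_eq0 invr_eq0 (negPf aF0) andbF orbF tofrac_eq0 => /eqP ->.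
  by exists s; rewrite rmorph0 mul0r addr0.
Qed.

(* The ideal (f) is prime, being the kernel of a morphism to a field. *)
Lemma iso_loc_closed_curve (f : {mpoly k[2]}) q :
  f != 0 -> curve_iso_loc f q -> closed_curve f.
Proof.
move=> f0 [u [v [_ _ _ ker]]]; rewrite -/(@constK1 k) in ker.
split=> // [|s t E].
  apply/negP=> fU; have : ev2 (@constK1 k) u v 1 = 0.
    by apply/ker; exists f^-1; rewrite mulVr.
  by move/eqP; rewrite rmorph1 oner_eq0.
have : ev2 (@constK1 k) u v f = 0 by apply/ker; exists 1; rewrite mul1r.
move/eqP; rewrite E rmorphM mulf_eq0 => /orP[] /eqP /ker [r Er].
- right; apply/unitrPr; exists r; apply: (mulfI f0).
  by rewrite mulr1 [RHS]E Er; ring.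
- left; apply/unitrPr; exists r; apply: (mulfI f0).
  by rewrite mulr1 [RHS]E Er; ring.
Qed.

End Graphs.

(** * Equivalences between graphs, by comparison of y-degrees *)

Section Rigidity.
Variable k : fieldType.
Implicit Types a b p q : {poly k}.

Let cXY : {rmorphism k -> {poly {poly k}}} := polyC \o polyC.

(** Regards k[x,y] as k[x][y], with y the outer variable, so that y-degrees are read off from
    sizes. *)
Definition toXY : {mpoly k[2]} -> {poly {poly k}} := ev2 cXY 'X%:P 'X.

HB.instance Definition _ :=
  GRing.RMorphism.copy toXY (ev2 cXY 'X%:P 'X).

Lemma toXYC c : toXY c%:MP = c%:P%:P. Proof. exact: (ev2C cXY). Qed.
Lemma toXYX : toXY (pX k) = 'X%:P. Proof. exact: ev2X. Qed.
Lemma toXYY : toXY (pY k) = 'X. Proof. exact: ev2Y. Qed.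

Lemma horner_map_cXY p (A : {poly {poly k}}) :
  (map_poly cXY p).[A] = map_poly polyC p \Po A.
Proof. by rewrite /comp_poly -map_poly_comp. Qed.

Lemma comp_map_polyC p q : map_poly polyC p \Po q%:P = (p \Po q)%:P.
Proof. by rewrite /comp_poly horner_map. Qed.

Lemma toXY_inX p : toXY (inX p) = p%:P.
Proof. by rewrite /toXY ev2_inX horner_map_cXY comp_map_polyC comp_polyXr. Qed.

Lemma toXY_graph a b : toXY (graph a b) = a%:P * 'X + b%:P.
Proof. by rewrite rmorphD rmorphM /= !toXY_inX toXYY. Qed.

Lemma toXY_subst2 A B (p : {mpoly k[2]}) : toXY (subst2 A B p) = ev2 cXY (toXY A) (toXY B) p.
Proof.
apply: (@ev2_unique _ _ cXY (toXY \o subst2 A B)) => [c||] /=.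
- by rewrite /subst2 ev2C toXYC.
- by rewrite /subst2 ev2X.
- by rewrite /subst2 ev2Y.
Qed.

(** Once x is known to go to some p in k[x], a substitution splits into composing the coefficients
    with p and then composing in y. *)
Lemma ev2_polyC p (B : {poly {poly k}}) (C : {mpoly k[2]}) :
  ev2 cXY p%:P B C = map_poly (comp_poly p) (toXY C) \Po B.
Proof.
apply/esym/(@ev2_unique _ _ cXY
  (comp_poly B \o (map_poly (comp_poly p) \o toXY))) => [c||] /=.
- by rewrite toXYC map_polyC /= comp_polyC comp_polyC.
- by rewrite toXYX map_polyC /= comp_polyC comp_polyX.
- by rewrite toXYY map_polyX comp_polyX.
Qed.

Lemma ev2_Y0 (A : {poly {poly k}}) (C : {mpoly k[2]}) :
  exists p, ev2 cXY A 0 C = map_poly polyC p \Po A.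
Proof.
exists (ev2 (@polyC k) 'X 0 C).
apply/esym/(@ev2_unique _ _ cXY
  (comp_poly A \o (map_poly polyC \o ev2 (@polyC k) 'X 0))) => [c||] /=.
- by rewrite ev2C map_polyC comp_polyC.
- by rewrite ev2X map_polyX comp_polyX.
- by rewrite ev2Y !rmorph0.
Qed.

Lemma size_map_polyC p : size (map_poly (@polyC k) p) = size p.
Proof. by apply: size_map_inj_poly; [apply: polyC_inj|]. Qed.

(* If deg_y A > 0, then a'(A) B + b'(A) has y-degree at least
   deg a' * deg_y A >= 2, whereas a y + b has y-degree 1. *)
Lemma graph_rigid a b a' b' :
  a != 0 -> (2 < size a')%N -> (size b' < size a')%N ->
  curve_equiv (graph a b) (graph a' b') ->
  exists p c d, [/\ size p = 2, c != 0, d != 0,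
    a' \Po p = d *: a & a %| b' \Po p - c *: b].
Proof.
move=> a0 sa' sb' [A0 [B0 [[C [D [HX HY _ _]]] [c [c0 E]]]]].
move/(congr1 toXY): HX; rewrite toXY_subst2 toXYX.
move/(congr1 toXY): HY; rewrite toXY_subst2 toXYY.
move/(congr1 toXY): E; rewrite toXY_subst2 rmorphM /= toXY_graph toXYC /=.
move: (toXY A0) (toXY B0) => A B {A0 B0}.
rewrite /graph rmorphD rmorphM /= !ev2_inX !horner_map_cXY ev2Y => E HY HX.
have sA : (size A <= 1)%N.
  rewrite leqNgt; apply/negP => sA.
  (* If B = 0, then x would be a polynomial in A, which is impossible when A involves y. *)
  have [B0|B0] := eqVneq B 0.
    have [p Ep] := ev2_Y0 A C; move: HX; rewrite B0 Ep => {}Ep.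
    have sE := size_comp_poly (map_poly polyC p) A; move: sE.
    rewrite Ep size_polyC polyX_eq0 size_map_polyC /= => sE.
    have sp : (size p <= 1)%N.
      by case: (size p) (size A) sA sE => [|[|m]] // [|[|n]] // _ /=; rewrite mulSn.
    move: Ep.
    rewrite [p](size1_polyC sp) map_polyC comp_polyC => /polyC_inj /(congr1 (fun P : {poly k} => size P)).
    by rewrite size_polyX size_polyC; case: (_ != 0).
  have a'0 : a' != 0 by rewrite -size_poly_gt0 (ltn_trans _ sa').
  have aA0 : map_poly polyC a' \Po A != 0.
    by rewrite comp_poly_eq0 // map_poly_eq0_id0 // polyC_eq0 lead_coef_eq0.
  have sX := size_comp_poly (map_poly polyC a') A.
  have sY := size_comp_poly (map_poly polyC b') A.
  rewrite !size_map_polyC in sX sY; move: E sX sY aA0.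
  move: (map_poly _ a' \Po A) (map_poly _ b' \Po A) => X Y E sX sY X0.
  have sXB := size_mul X0 B0; have X1 : (0 < size X)%N by rewrite size_poly_gt0.
  have B1 : (0 < size B)%N by rewrite size_poly_gt0.
  (* As deg b' < deg a', the term b'(A) cannot cancel the leading term of a'(A) B. *)
  have ltYX : (size Y < size (X * B)%R)%N.
    have : ((size b').-1 * (size A).-1 < (size a').-1 * (size A).-1)%N.
      by rewrite ltn_pmul2r; lia.
    rewrite -sX -sY [size (X * B)]sXB.
    by move: X1 B1; move: (size X) (size Y) (size B) => x y z; lia.
  have sX2 : (2 * 1 <= (size X).-1)%N 
    by rewrite sX; move: (size a') (size A) sa' sA => x y; nia.
  have sR : (size (c%:P%:P * (a%:P * 'X + b%:P) : {poly {poly k}})%R <= 2)%N.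
    rewrite mul_polyC (leq_trans (size_scale_leq _ _)) // size_MXaddC.
    by case: ifP => // _; rewrite ltnS size_polyC leq_b1.
  have := size_polyDl ltYX; rewrite E sXB => sE.
  by move: sR X1 B1 sX2; rewrite sE; move: (size X) (size B) => x z; lia.
move: E HX HY; rewrite [A](size1_polyC sA); move: A`_0 => p {A sA}.
rewrite !ev2_polyC !comp_map_polyC => E HX HY.
have coefE i : (a' \Po p) * B`_i + (b' \Po p) *+ (i == 0%N) =
    c%:P * (a *+ (i == 1%N) + b *+ (i == 0%N)).
  have := congr1 (fun P : {poly {poly k}} => P`_i) E.
  by rewrite /= coefD !coefCM coefD coefCM coefX !coefC; case: i => [|[|i]];
     rewrite /= ?mulr1 ?mulr0 ?addr0 ?add0r.
have E1 := coefE 1%N; rewrite /= !addr0 in E1.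
have ca0 : c%:P * a != 0 by rewrite mulf_neq0 // polyC_eq0.
have ap0 : a' \Po p != 0 by apply: contra_neq ca0 => a'0; rewrite -E1 a'0 mul0r.
have B1 : B`_1 != 0 by apply: contra_neq ca0 => B1; rewrite -E1 B1 mulr0.
have sB : size B = 2.
  apply/eqP; rewrite eqn_leq; apply/andP; split; last first.
    by rewrite ltnNge; apply/negP => /leq_sizeP /(_ 1%N isT) /eqP; apply/negP.
  apply/leq_sizeP => [[|[|i]]] // _; have := coefE i.+2.
  by rewrite /= !addr0 mulr0 => /eqP; rewrite mulf_eq0 (negPf ap0) => /eqP.
(* By surjectivity x is a polynomial in p(x), which forces deg p = 1. *)
have sp : size p = 2.
  have := congr1 (fun P : {poly {poly k}} => size P) HX.
  rewrite size_comp_poly2 // size_polyC polyX_eq0 /= => sE.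
  move: HX; rewrite [map_poly _ _]size1_polyC ?sE // comp_polyC => /polyC_inj.
  rewrite coef_map /= => /(congr1 (fun P : {poly k} => size P)) sp.
  have := size_comp_poly (toXY C)`_0 p; rewrite sp size_polyX /=.
  by move/esym/eqP; rewrite muln_eq1 => /andP[_ /eqP]; case: (size p) => //= n ->.
(* By surjectivity y is a polynomial in B of degree 1, so the leading coefficient of B is a unit of
   k[x], that is, a constant. *)
have [s s0 Es] : exists2 s, s != 0 & B`_1 = s%:P.
  have := congr1 (fun P : {poly {poly k}} => size P) HY.
  rewrite size_comp_poly2 // size_polyX => sE.
  move/(congr1 lead_coef): HY; rewrite lead_coef_comp ?sB // sE expr1 lead_coefX.
  rewrite [lead_coef B]lead_coefE sB /= => HU.
  have : B`_1 \is a GRing.unit by apply/unitrPr; exists (lead_coef (map_poly (comp_poly p) (toXY D))); rewrite mulrC.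
  rewrite poly_unitE => /andP[/eqP sB1 _]; exists B`_1`_0; last by apply: size1_polyC; rewrite sB1.
  by apply: contra_neq B1 => B10; rewrite [B`_1]size1_polyC ?sB1 // B10.
have E0 := coefE 0%N; rewrite /= add0r in E0.
have Ea : a' \Po p = (c / s) *: a.
  rewrite mulrC -scalerA -[c *: a]mul_polyC -E1 Es mulrC mul_polyC scalerA mulVf //.
  by rewrite scale1r.
exists p, c, (c / s); split; rewrite ?mulf_neq0 ?invr_neq0 //.
(* The y-free part of the equation reads b'(p) - c b = - a'(p) B_0, a multiple of a. *)
rewrite -mul_polyC -E0 opprD addrCA subrr addr0 Ea dvdpNr.
by rewrite dvdp_mulr // dvdpZr ?dvdpp // mulf_neq0 ?invr_neq0.
Qed.

End Rigidity.

(** * Complements of graphs: inversion of f and monomial automorphisms *)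

Section GraphComplements.
Variable k : fieldType.
Implicit Types a b : {poly k}.

Lemma graph_neq0 a b : a != 0 -> graph a b != 0.
Proof.
move=> a0; apply: contra_neq a0 => /(congr1 (@toXY k)).
rewrite toXY_graph rmorph0 => /(congr1 (fun P : {poly {poly k}} => P`_1)).
by rewrite coefD coefCM coefX coefC coef0 mulr1 addr0.
Qed.

Lemma evK_graph u v a b : evK u v (graph a b) =
  (map_poly (@constK2 k) a).[u] * v + (map_poly (@constK2 k) b).[u].
Proof. by rewrite rmorphD rmorphM /= !evK_inX evKY. Qed.

Lemma tofrac_graph a b :
  (graph a b)%:F = (inX a)%:F * (pY k)%:F + (inX b)%:F.
Proof. by rewrite rmorphD rmorphM. Qed.

(** The second coordinates solve a y' + b = 1/g and a y' + b' = 1/f; the relation b b' = 1 + a e is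
    what makes division by a possible. One half suffices, since the hypothesis is symmetric in b and
    b'. *)
Lemma graph_twist_half a b b' e : a != 0 -> b * b' = 1 + a * e ->
  let f := graph a b in let g := graph a b' in
  left_inverse_pair f g
    (pX k)%:F ((- inX b * pY k - inX e)%:F / g%:F)
    (pX k)%:F ((- inX b' * pY k - inX e)%:F / f%:F).
Proof.
move=> a0 bb' f g.
have E : (inX b)%:F * (inX b')%:F = 1 + (inX a)%:F * (inX e)%:F.
  by rewrite -!rmorphM /= bb' !rmorphD /= !rmorph1.
have f0 : f%:F != 0 by rewrite tofrac_eq0 graph_neq0.
have Eg : evK (pX k)%:F ((- inX b' * pY k - inX e)%:F / f%:F) g = f%:F^-1.
  rewrite evK_graph -!tofrac_inX; apply: (mulIf f0).
  rewrite mulVf // mulrDl -mulrA mulfVK // /f tofrac_graph.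
  rewrite rmorphB rmorphM rmorphN /=.
  apply: (@addrI _ ((inX a)%:F * (inX e)%:F)); rewrite [RHS]addrC -E; ring.
split.
- by exists (pX k), 0%N; rewrite evKX !expr0; split; rewrite ?divr1 ?mulr1.
- exists (- inX b * pY k - inX e), 1%N; split; first by rewrite expr1.
  rewrite Eg rmorphB rmorphM rmorphN /= evKY !evK_inX -!tofrac_inX expr1.
  apply: (mulIf f0); rewrite mulfVK // mulrBl -mulrA mulfVK //.
  rewrite /f tofrac_graph rmorphB rmorphM rmorphN /=.
  transitivity ((pY k)%:F * ((inX b)%:F * (inX b')%:F - (inX a)%:F * (inX e)%:F)); first by ring.
  by rewrite E addrK mulr1.
- by rewrite Eg invr_neq0.
- by rewrite Eg invrK; apply: locK2_tofrac.
Qed.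

(* On the complement of f, the new coordinate y' solves a(x) y' + b'(x) = 1/f. *)
Lemma graph_compl_iso_inv a b b' e : a != 0 -> b * b' = 1 + a * e ->
  compl_iso (graph a b) (graph a b').
Proof.
move=> a0 E; have E' : b' * b = 1 + a * e by rewrite mulrC.
exact: inverse_pairs_compl_iso (conj (graph_twist_half a0 E) (graph_twist_half a0 E')).
Qed.

(** Both substitutions preserve x^m y, hence f, so multiplying and dividing by powers of f undo each
    other. *)
Lemma monomial_graph_automorphism m n :
  let f := graph 'X^m 1 in
  inverse_pairs f f
    ((pX k)%:F * f%:F ^+ n) ((pY k)%:F / f%:F ^+ (n * m))
    ((pX k)%:F / f%:F ^+ n) ((pY k)%:F * f%:F ^+ (n * m)).
Proof.
move=> f; have f0 : f%:F != 0 by rewrite tofrac_eq0 graph_neq0 // expf_neq0 ?polyX_eq0.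
have Xf0 i : f%:F ^+ i != 0 by rewrite expf_neq0.
have Ef : f%:F = (pX k)%:F ^+ m * (pY k)%:F + 1.
  by rewrite tofrac_graph rmorph1 tofrac1 !rmorphXn /= inXX.
have E1 : evK ((pX k)%:F * f%:F ^+ n) ((pY k)%:F / f%:F ^+ (n * m)) f = f%:F.
  rewrite evK_graph map_polyXn hornerXn rmorph1 hornerC [RHS]Ef exprMn -exprM.
  by rewrite mulrACA (mulfV (Xf0 _)) mulr1.
have E2 : evK ((pX k)%:F / f%:F ^+ n) ((pY k)%:F * f%:F ^+ (n * m)) f = f%:F.
  rewrite evK_graph map_polyXn hornerXn rmorph1 hornerC [RHS]Ef exprMn exprVn -exprM.
  by rewrite mulrACA (mulVf (Xf0 _)) mulr1.
have fV : locK2 f f%:F^-1 by exists 1, 1%N; rewrite tofrac1 mul1r.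
split; split; rewrite ?E1 ?E2 //.
- exists (pX k * f ^+ n), 0%N; rewrite rmorphM rmorphXn !expr0 divr1; split=> //.
  by rewrite rmorphM rmorphXn /= evKX E2 (mulfVK (Xf0 _)) mulr1.
- by exists (pY k), (n * m)%N; rewrite evKY.
- by exists (pX k), n; rewrite evKX.
- exists (pY k * f ^+ (n * m)), 0%N; rewrite rmorphM rmorphXn !expr0 divr1; split=> //.
  by rewrite rmorphM rmorphXn /= evKY E1 (mulfVK (Xf0 _)) mulr1.
Qed.

(* If phi_j = alpha o phi_i, applying the inverse of phi_i shows that
   x / f^(i-j) or y / f^(m(j-i)) is a polynomial. *)
Lemma monomial_graph_inf_many_embs m : inf_many_embs (graph ('X^(m.+1) : {poly k}) 1).
Proof.
set f := graph _ _.
exists (fun n => ((pX k)%:F * f%:F ^+ n, (pY k)%:F / f%:F ^+ (n * m.+1))).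
split=> [i|i j ij [A [B [_ /= [EA EB]]]]].
  exact: inverse_pairs_open_emb (monomial_graph_automorphism m.+1 i).
have f0 : f%:F != 0 by rewrite tofrac_eq0 graph_neq0 // expf_neq0 ?polyX_eq0.
have Xf0 n : f%:F ^+ n != 0 by rewrite expf_neq0.
have [L L'] := monomial_graph_automorphism m.+1 i; rewrite -/f in L L'.
have inj' := left_inverse_pair_inj L'.
have Ef : evK ((pX k)%:F / f%:F ^+ i) ((pY k)%:F * f%:F ^+ (i * m.+1)) f = f%:F.
  rewrite evK_graph map_polyXn hornerXn rmorph1 hornerC.
  rewrite exprMn exprVn -exprM mulrACA (mulVf (Xf0 _)) mulr1.
  by rewrite /f tofrac_graph rmorph1 tofrac1 !rmorphXn /= inXX.
have X0 : 'X%:F != 0 :> K1 k by rewrite tofrac_eq0 polyX_eq0.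
(* A multiple of f vanishes on the parametrization t |-> (t, - 1/t^(m+1)) of the curve, where
   neither x nor y does. *)
have F0 n P : (0 < n)%N -> ev2 (@constK1 k) 'X%:F (- 1%:F / ('X^(m.+1))%:F) (P * f ^+ n) = 0.
  move=> n0; rewrite rmorphM rmorphXn /= graph_root ?expf_neq0 ?polyX_eq0 //.
  by rewrite expr0n (gtn_eqF n0) mulr0.
have neqX n P : (0 < n)%N -> pX k <> P * f ^+ n.
  by move=> n0 E; move: (F0 n P n0); rewrite -E ev2X; apply/eqP.
have neqY n P : (0 < n)%N -> pY k <> P * f ^+ n.
  move=> n0 E; move: (F0 n P n0); rewrite -E ev2Y; apply/eqP.
  rewrite mulf_eq0 negb_or oppr_eq0 invr_eq0 !tofrac_eq0 oner_eq0 /=.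
  by rewrite expf_eq0 polyX_eq0.
case: (ltngtP i j) => [ltij|ltji|//].
- move/(congr1 (frac_ext inj')): EB; rewrite (frac_ext_evK L) => EB.
  apply: (neqY ((j - i) * m.+1)%N B); first by rewrite muln_gt0 subn_gt0 ltij.
  apply/eqP; rewrite -tofrac_eq rmorphM rmorphXn /= -EB frac_ext_divX /= evKY Ef.
  have -> : (j * m.+1 = i * m.+1 + (j - i) * m.+1)%N.
    by rewrite -mulnDl subnKC // ltnW.
  rewrite exprD invfM mulrA (mulfK (Xf0 _)).
  by rewrite (mulfVK (Xf0 _)).
- have Ej : (pX k)%:F * f%:F ^+ j = (pX k * f ^+ j)%:F by rewrite rmorphM rmorphXn.
  move: EA; rewrite Ej => /(congr1 (frac_ext inj')); rewrite (frac_ext_evK L) => EA.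
  apply: (neqX (i - j)%N A); first by rewrite subn_gt0.
  apply/eqP; rewrite -tofrac_eq rmorphM rmorphXn /= -EA frac_ext_tofrac /=.
  rewrite rmorphM rmorphXn /= evKX Ef -mulrA -exprD.
  by rewrite (subnKC (ltnW ltji)) (mulfVK (Xf0 _)).
Qed.

End GraphComplements.

(** The factor theorem at t. Over k[x] and k[x,y] it transports congruences through polynomial
    expressions with an explicit quotient. *)
Lemma horner_sub_factor (R : comNzRingType) (p : {poly R}) (s t : R) :
  exists r, p.[s] - p.[t] = r * (s - t).
Proof.
have /factor_theorem [q E] : root (p - p.[t]%:P) t by rewrite rootE !hornerE subrr.
exists q.[s]; move/(congr1 (horner^~ s)): E.
by rewrite !hornerE.
Qed.

(** * The shear x (1 + x)^j and its truncated inverse *)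

Section TruncatedInverse.
Variables (k : fieldType) (j : nat).
Implicit Types (p q r : {poly k}) (m n : nat).

(** This is x f^j modulo x^m for f = x^m y + 1 + x. *)
Definition shear : {poly k} := 'X * (1 + 'X) ^+ j.

(* The compositional inverse of [shear] modulo 'X^m. *)
Fixpoint shear_inv m : {poly k} :=
  if m is n.+1 then
    shear_inv n - (shear_inv n \Po shear - 'X)`_n *: 'X^n
  else 0.

Lemma size_shear_inv m : (size (shear_inv m) <= m)%N.
Proof.
elim: m => [|m IHm] /=; first by rewrite size_poly0.
rewrite (leq_trans (size_polyD _ _)) // geq_max (leq_trans IHm) //.
by rewrite size_polyN (leq_trans (size_scale_leq _ _)) // size_polyXn.
Qed.

Lemma dvdXE p : ('X %| p) = (p.[0] == 0).
Proof. by rewrite -['X]subr0 -polyC0 dvdp_XsubCl rootE. Qed.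

Lemma dvdXnS p m : 'X^m %| p -> p`_m = 0 -> 'X^(m.+1) %| p.
Proof.
move=> /dvdpP[q ->]; rewrite coefMXn ltnn subnn exprS => q0.
by rewrite dvdp_mul2r ?expf_neq0 ?polyX_eq0 // dvdXE horner_coef0 q0.
Qed.

(** The m-th power of the shear begins with x^m with coefficient 1, so the correction term removes
    exactly the coefficient of x^m in the error. *)
Lemma shear_invP m : 'X^m %| shear_inv m \Po shear - 'X.
Proof.
elim: m => [|m IHm]; first by rewrite expr0 dvd1p.
rewrite /=; set c := _`_m; rewrite comp_polyB comp_polyZ comp_Xn_poly.
have E : shear ^+ m = 'X^m * (1 + 'X) ^+ (j * m) by rewrite /shear exprMn exprM.
have s0 : (shear ^+ m)`_m = 1.
  rewrite E mulrC coefMXn ltnn subnn -horner_coef0 horner_exp !hornerE.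
  exact: expr1n.
apply: dvdXnS.
  by rewrite addrAC dvdp_sub // -mul_polyC E dvdp_mull // dvdp_mulr.
by rewrite addrAC coefB coefZ s0 mulr1 subrr.
Qed.

Lemma dvdXn_comp_shear p m : 'X^m %| p -> 'X^m %| p \Po shear.
Proof.
move=> /dvdpP[q ->]; rewrite comp_polyM comp_Xn_poly /shear exprMn.
by rewrite dvdp_mull // dvdp_mulr.
Qed.

Lemma coprimeXn_1DX m n : coprimep ('X^m : {poly k}) ((1 + 'X) ^+ n).
Proof.
apply/coprimep_expl/coprimep_expr; rewrite coprimep_sym coprimepX rootE.
by rewrite !hornerE oner_eq0.
Qed.

(** The shear is x times a polynomial prime to x, so composing with it does not raise the order at
    0. *)
Lemma dvdXn_comp_shearE p m : 'X^m %| p \Po shear -> 'X^m %| p.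
Proof.
elim: m p => [|m IHm] p; first by rewrite expr0 !dvd1p.
move=> H; have /dvdpP[q Ep] : 'X %| p.
  have : 'X %| p \Po shear by apply: dvdp_trans H; rewrite exprS dvdp_mulr.
  by rewrite !dvdXE horner_comp /shear hornerM hornerX mul0r.
move: H; rewrite Ep comp_polyM comp_polyX /shear mulrCA exprS dvdp_mul2l ?polyX_eq0 //.
rewrite Gauss_dvdpl ?coprimeXn_1DX // => /IHm.
by rewrite -exprS exprSr dvdp_mul2r ?polyX_eq0.
Qed.

Lemma dvdp_horner_sub (p : {poly {poly k}}) (d s t : {poly k}) :
  d %| s - t -> d %| p.[s] - p.[t].
Proof. by have [r ->] := horner_sub_factor p s t; apply: dvdp_mull. Qed.

(** The left inverse is also a right inverse: after composition with the shear both terms agree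
    modulo x^m, and the composition can be cancelled. *)
Lemma shear_inv_implicit m :
  'X^m %| shear_inv m * (1 + shear_inv m) ^+ j - 'X.
Proof.
apply: dvdXn_comp_shearE; set h := shear_inv m.
pose P : {poly {poly k}} := 'X * (1 + 'X) ^+ j.
rewrite comp_polyB comp_polyM comp_polyX rmorphXn /= comp_polyD comp_polyC.
have := dvdp_horner_sub P (shear_invP m).
by rewrite /P !hornerE.
Qed.

End TruncatedInverse.

(** * Isomorphisms between complements of sheared graphs *)

Section ShearedGraphs.
Variable k : fieldType.
Implicit Types (i j m n : nat).

(** Used with G = g^j, H = g^(j m) and X = x^(m+1) to check that f pulls back to g. *)
Lemma shear_rational_identity (F : fieldType) (X G H W x : F) : G != 0 -> H != 0 ->
  (X / (G * H) * (W * H) + (1 + x / G)) * G = X * W + x + G.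
Proof. by move=> G0 H0; field; rewrite G0 H0. Qed.

Lemma evK_horner u v (p : {poly k}) (w : {mpoly k[2]}) :
  evK u v (map_poly (@mpolyC 2 k) p).[w] = (map_poly (@constK2 k) p).[evK u v w].
Proof.
rewrite -[LHS]/((evK u v) _) -horner_map -map_poly_comp; congr _.[_].
by apply: eq_map_poly => c /=; rewrite evKC.
Qed.

Lemma inX_comp (p q : {poly k}) :
  inX (p \Po q) = (map_poly (@mpolyC 2 k) p).[inX q].
Proof. by rewrite /inX map_comp_poly horner_comp. Qed.

(* On the complement of f the new coordinates are x' = x f^j and
   y' = (f - b(x')) / x'^m. *)
Lemma sheared_inverse_pairs j m :
  let f : {mpoly k[2]} := graph 'X^(m.+1) (1 + 'X) in
  let g : {mpoly k[2]} := graph 'X^(m.+1) (1 + shear_inv k j m.+1) in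
  exists u v u' v', inverse_pairs f g u v u' v'.
Proof.
move=> f; set h := shear_inv k j m.+1; move=> g.
have XM0 : 'X^(m.+1) != 0 :> {poly k} by rewrite expf_neq0 ?polyX_eq0.
have f0 : f%:F != 0 by rewrite tofrac_eq0 graph_neq0.
have g0 : g%:F != 0 by rewrite tofrac_eq0 graph_neq0.
have Ef : f = pX k ^+ m.+1 * pY k + (1 + pX k).
  by rewrite /f /graph rmorphD rmorph1 rmorphXn /= inXX.
have Eg : g = pX k ^+ m.+1 * pY k + inX (1 + h).
  by rewrite /g /graph rmorphXn /= inXX.
have /dvdpP[q1 Eq1] : 'X^(m.+1) %| h \Po shear k j - 'X := shear_invP k j m.+1.
have /dvdpP[q2 Eq2] : 'X^(m.+1) %| h * (1 + h) ^+ j - 'X.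
  exact: shear_inv_implicit.
clearbody h f g.
have fX n : f%:F ^+ n != 0 := expf_neq0 n f0.
have gX n : g%:F ^+ n != 0 := expf_neq0 n g0.
have x0 : (pX k)%:F != 0.
  rewrite tofrac_eq0 -inXX; apply/eqP => /(congr1 (@toXY k)) /eqP.
  by rewrite toXY_inX rmorph0 polyC_eq0 polyX_eq0.
have x0m : (pX k)%:F ^+ m.+1 != 0 by rewrite expf_neq0.
have [r0 Er0] : exists r, f ^+ j - (1 + pX k) ^+ j = r * (pX k ^+ m.+1 * pY k).
  have [r] := horner_sub_factor 'X^j f (1 + pX k); rewrite !hornerXn => ->.
  by exists r; rewrite [X in X - (1 + _)]Ef addrK.
(* Modulo x^(m+1), f is 1 + x, so x f^j is the shear, which h sends back to x. T is the numerator of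
   y'. *)
have [T ET] : exists T, f - (map_poly (@mpolyC 2 k) (1 + h)).[pX k * f ^+ j] =
    pX k ^+ m.+1 * T.
  have [r Er] := horner_sub_factor (map_poly (@mpolyC 2 k) (1 + h))
                   (pX k * f ^+ j) (inX (shear k j)).
  exists (pY k - inX q1 - r * pX k * r0 * pY k).
  move/eqP: Er; rewrite subr_eq => /eqP ->.
  rewrite -inX_comp comp_polyD comp_polyC.
  move/eqP: Eq1; rewrite subr_eq => /eqP ->.
  rewrite !(rmorphD, rmorphM, rmorphXn, rmorph1) /= ?inXX.
  by rewrite {1}Ef -mulrBr Er0; ring.
(* Modulo x^(m+1), g is 1 + h and h (1 + h)^j is x. W is, up to a power of g, the second coordinate
   of the inverse. *)
have [W EW] : exists W, g ^+ j.+1 - g ^+ j - pX k = pX k ^+ m.+1 * W.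
  have [r Er] := horner_sub_factor ('X^(j.+1) - 'X^j) g (inX (1 + h)).
  exists (r * pY k + inX q2); move: Er; rewrite !hornerE [X in X - inX _]Eg addrK.
  have := congr1 (@inX k) Eq2; rewrite !(rmorphM, rmorphXn, rmorphB) /= inXX => Eq.
  move/eqP; rewrite subr_eq => /eqP ->.
  have Eh : inX h = inX (1 + h) - 1 by rewrite rmorphD rmorph1 addrC addKr.
  by rewrite mulrDr [X in _ = _ + X]mulrC -Eq Eh [inX _ ^+ _]exprS; ring.
set x := (pX k)%:F in x0 *; set y := (pY k)%:F.
have [u Eu] : exists u, u = x / g%:F ^+ j by eexists.
have [v Ev] : exists v, v = W%:F * g%:F ^+ (j * m) by eexists.
have [u' Eu'] : exists u', u' = x * f%:F ^+ j by eexists.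
have [v' Ev'] : exists v', v' = T%:F / f%:F ^+ (j * m.+1) by eexists.
have EfF : f%:F = x ^+ m.+1 * y + (1 + x).
  by rewrite {1}Ef !(rmorphD, rmorphM, rmorphXn, rmorph1).
have EgF : g%:F = x ^+ m.+1 * y + (inX (1 + h))%:F.
  by rewrite {1}Eg rmorphD rmorphM rmorphXn.
have u'E : u' = (pX k * f ^+ j)%:F by rewrite Eu' rmorphM rmorphXn.
have E1 : evK u v f = g%:F.
  apply: (mulIf (gX j)); rewrite -exprS {1}Ef !(rmorphD, rmorphM, rmorphXn) /=.
  rewrite rmorph1 evKX evKY.
  have := congr1 (@FracField.tofrac _) EW.
  rewrite !(rmorphB, rmorphM, rmorphXn) /= => /eqP; rewrite -/x !subr_eq => /eqP ->.
  rewrite Eu Ev exprMn exprVn -exprM mulnS exprD.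
  exact: shear_rational_identity (gX j) (gX (j * m)%N).
have E2 : evK u' v' g = f%:F.
  rewrite {1}Eg rmorphD rmorphM rmorphXn /= evKX evKY evK_inX {2}u'E horner_tofrac_inX.
  move/eqP: ET; rewrite subr_eq => /eqP EfT; rewrite [in RHS]EfT.
  rewrite !(rmorphD, rmorphM, rmorphXn) /= -/x; congr (_ + _).
  by rewrite Eu' Ev' exprMn -exprM mulrA mulrAC (mulfK (fX _)).
have fV : locK2 f f%:F^-1 by exists 1, 1%N; rewrite tofrac1 mul1r.
have gV : locK2 g g%:F^-1 by exists 1, 1%N; rewrite tofrac1 mul1r.
exists u, v, u', v'; split; split; rewrite ?E1 ?E2; [| | exact: f0 | exact: fV | | | exact: g0 | exact: gV].
- by exists (pX k), j; rewrite evKX.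
- exists (W * g ^+ (j * m)), 0%N; rewrite rmorphM rmorphXn !expr0 divr1; split=> //.
  rewrite rmorphM rmorphXn /= E2 mulr1.
  have := congr1 (evK u' v') EW.
  rewrite !(rmorphB, rmorphM, rmorphXn) /= E2 evKX exprS Eu' exprMn -exprM mulnS exprD.
  move=> H; apply: (mulfI x0m); apply: (mulfI (fX j)).
  rewrite -/x -/y (_ : x ^+ m.+1 * y = f%:F - (1 + x)); last by rewrite EfF addrK.
  transitivity (f%:F * f%:F ^+ j - f%:F ^+ j - x * f%:F ^+ j); last by ring.
  by rewrite H; ring.
- exists (pX k * f ^+ j), 0%N; rewrite u'E expr0 divr1; split=> //.
  by rewrite rmorphM rmorphXn /= E1 evKX Eu (mulfVK (gX _)) mulr1.
- exists T, (j * m.+1)%N; split=> //.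
  have := congr1 (evK u v) ET.
  rewrite rmorphB !(rmorphM, rmorphXn) /= evK_horner rmorphM rmorphXn /= E1 evKX.
  rewrite {1}Eu (mulfVK (gX _)) -tofrac_inX {1}EgF addrK Eu exprMn exprVn -exprM.
  move=> H; apply: (mulfI x0m); rewrite mulrA -/x -/y H.
  by rewrite mulrAC (mulfVK (gX _)).
Qed.

End ShearedGraphs.

(** * Inequivalence of sheared graphs *)

Section ShearedRigidity.
Variable k : fieldType.
Implicit Types (h p : {poly k}) (i j m n : nat).

Lemma dvdXX p : 'X^2 %| p -> p.[0] = 0 /\ p^`().[0] = 0.
Proof.
move=> /dvdpP[q ->]; rewrite exprS expr1 !derivM derivX !hornerE /=.
by rewrite !mulr0 !mul0r addr0.
Qed.

(** The shear is tangent to the identity at 0, hence so is its inverse truncated at order at least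
    2. *)
Lemma shear_inv0 j m : (shear_inv k j m.+2).[0] = 0 /\ (shear_inv k j m.+2)^`().[0] = 1.
Proof.
have s0 : (shear k j).[0] = 0 by rewrite hornerM hornerX mul0r.
have s1 : (shear k j)^`().[0] = 1.
  by rewrite derivM derivX !hornerE /= expr1n.
have := shear_invP k j m.+2; move: (shear_inv _ _ _) => h dvdh.
have /dvdXX[] : 'X^2 %| h \Po shear k j - 'X.
  by apply: dvdp_trans dvdh; rewrite dvdp_exp2l.
rewrite derivB deriv_comp derivX !hornerE !horner_comp s0 s1 mulr1 subr0 => -> /eqP.
by rewrite subr_eq0 => /eqP.
Qed.

(** The affine map p preserves the zero of x^(m+2), so p = t x. Values and derivatives at 0 then
    give c = 1 and t = 1, leaving only h' - h. *)
Lemma tangent_graph_rigid m h h' : (size h' <= m.+2)%N ->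
  h.[0] = 0 -> h^`().[0] = 1 -> h'.[0] = 0 -> h'^`().[0] = 1 ->
  curve_equiv (graph 'X^(m.+2) (1 + h)) (graph 'X^(m.+2) (1 + h')) ->
  'X^(m.+2) %| h' - h.
Proof.
move=> sh' h0 h1 h'0 h'1; case/graph_rigid=> [|||p [c [d [sp c0 d0 Ep]]]].
- by rewrite expf_neq0 ?polyX_eq0.
- by rewrite size_polyXn.
- by rewrite size_polyXn ltnS (leq_trans (size_polyD _ _)) // geq_max size_polyC oner_eq0.
have p0 : p.[0] = 0.
  move/(congr1 (horner^~ 0))/eqP: Ep; rewrite comp_Xn_poly horner_exp hornerZ hornerXn.
  by rewrite expr0n mulr0 expf_eq0 => /eqP.
have /dvdpP[q Eq] : 'X %| p by rewrite dvdXE p0.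
have [t Et] : exists t, p = t *: 'X.
  exists q`_0; rewrite Eq -mul_polyC -size1_polyC //.
  have q0 : q != 0 by apply: contra_eq_neq sp => q0; rewrite Eq q0 mul0r size_poly0.
  by move: sp; rewrite Eq size_mulX // => -[->].
rewrite comp_polyD comp_polyC => dvdP.
have /dvdXX[] : 'X^2 %| 1%:P + (h' \Po p) - c *: (1 + h).
  by apply: dvdp_trans dvdP; rewrite dvdp_exp2l.
rewrite derivB derivD derivZ derivD -polyC1 !derivC deriv_comp !add0r !hornerE.
rewrite !horner_comp p0 h'0 h'1 h0 h1 !addr0 mulr1 mul1r {1}Et derivZ derivX !hornerE.
move=> /eqP; rewrite subr_eq0 => /eqP c1 /eqP; rewrite -c1 subr_eq0 => /eqP t1.
move: dvdP; rewrite Et -c1 t1 !scale1r comp_polyXr; congr (_ %| _).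
by rewrite polyC1; ring.
Qed.

(* Composing h_i (1 + h_i)^i = X = h_j (1 + h_j)^j with the shear of index i
   turns h_i = h_j into X (1 + X)^i = X (1 + X)^j. *)
Lemma shear_inv_eq_mod m i j : (i <= j)%N ->
  'X^(m.+1) %| shear_inv k j m.+1 - shear_inv k i m.+1 ->
  'X^m %| ((1 + 'X) ^+ (j - i) - 1 : {poly k}).
Proof.
move=> leij dvdh; pose P n : {poly {poly k}} := 'X * (1 + 'X) ^+ n.
have PE n h : (P n).[h] = h * (1 + h) ^+ n by rewrite /P !hornerE.
have := shear_inv_implicit k j m.+1; rewrite -PE.
have := shear_inv_implicit k i m.+1; rewrite -PE.
have := shear_invP k i m.+1; move: dvdh.
move: (shear_inv k i m.+1) (shear_inv k j m.+1) => hi hj dvdh Dcomp Di Dj.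
have D1 : 'X^(m.+1) %| (P j).[hi] - (P i).[hi].
  have -> : (P j).[hi] - (P i).[hi] = ((P j).[hj] - 'X) - ((P j).[hj] - (P j).[hi]) - ((P i).[hi] - 'X).
    by ring.
  by apply: dvdp_sub Di; apply: dvdp_sub Dj _; apply: dvdp_horner_sub.
have D2 : 'X^(m.+1) %| (P j).['X] - (P i).['X].
  have PC n : (P n).[hi] \Po shear k i = (P n).[hi \Po shear k i].
    by rewrite !PE comp_polyM rmorphXn /= comp_polyD comp_polyC.
  have := dvdXn_comp_shear i D1; rewrite comp_polyB !PC => D.
  have Ei n := dvdp_horner_sub (P n) Dcomp.
  have -> : (P j).['X] - (P i).['X] =
      (P j).[hi \Po shear k i] - (P i).[hi \Po shear k i] -
      ((P j).[hi \Po shear k i] - (P j).['X]) +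
      ((P i).[hi \Po shear k i] - (P i).['X]) by ring.
  by apply: dvdp_add; [apply: dvdp_sub|].
move: D2; rewrite !PE.
have -> : 'X * (1 + 'X) ^+ j - 'X * (1 + 'X) ^+ i =
    'X * ((1 + 'X) ^+ i * ((1 + 'X) ^+ (j - i) - 1)) :> {poly k}.
  by rewrite -{1}(subnKC leij) exprD; ring.
by rewrite exprS dvdp_mul2l ?polyX_eq0 // Gauss_dvdpr // coprimeXn_1DX.
Qed.

End ShearedRigidity.

(** * The families of curves *)

Section CurveFamilies.
Variable k : fieldType.
Implicit Types (p q : {poly k}) (i j m n d : nat).

(** The exponent is at least 2, as needed for rigidity and for comparing first derivatives at 0. *)
Definition sheared_graph m j : {mpoly k[2]} :=
  graph 'X^(m.+2) (1 + shear_inv k j m.+2).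

(** All these complements are isomorphic to that of x^(m+2) y + 1 + x. *)
Lemma sheared_graph_compl_iso m i j :
  compl_iso (sheared_graph m i) (sheared_graph m j).
Proof.
have [u [v [u' [v' Ii]]]] := sheared_inverse_pairs k i m.+1.
have [s [t [s' [t' Ij]]]] := sheared_inverse_pairs k j m.+1.
apply: compl_iso_trans (inverse_pairs_compl_iso (inverse_pairs_sym Ii)) _.
exact: inverse_pairs_compl_iso Ij.
Qed.

Lemma sheared_graph_iso_loc m j : curve_iso_loc (sheared_graph m j) (tpoly k).
Proof.
have [h0 _] := shear_inv0 k j m; rewrite /sheared_graph.
move: (shear_inv _ _ _) h0 => h h0.
have /Bezout_eq1_coprimepP[[u v] /= uv] : coprimep (1 + h) 'X^(m.+2).
  by apply: coprimep_expr; rewrite coprimepX rootE hornerD hornerC h0 addr0 oner_eq0.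
by apply: (graph_iso_loc (q := 'X) (N := m.+1)) uv; rewrite ?polyX_eq0.
Qed.

(** Here d = |i - j|. The bound on d gives a contradiction by degree when m is large; in
    characteristic 0 the linear coefficient d already does. *)
Lemma sheared_graph_equiv m i j : i <> j ->
  curve_equiv (sheared_graph m i) (sheared_graph m j) ->
  exists d, (0 < d <= maxn i j)%N /\ 'X^(m.+1) %| ((1 + 'X) ^+ d - 1 : {poly k}).
Proof.
move=> ij; have [[hi0 hi1] [hj0 hj1]] := (shear_inv0 k i m, shear_inv0 k j m).
move/(tangent_graph_rigid (size_shear_inv k j m.+2) hi0 hi1 hj0 hj1) => D.
case: (ltngtP i j) => [ltij|ltji|//].
- exists (j - i)%N; rewrite subn_gt0 ltij leq_subr.
  by split=> //; apply: shear_inv_eq_mod D; apply: ltnW.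
- exists (i - j)%N; rewrite subn_gt0 ltji leq_subr; split=> //.
  apply: shear_inv_eq_mod; first exact: ltnW.
  by rewrite -opprB dvdpNr.
Qed.

(** In every characteristic (1 + x)^d - 1 has degree exactly d, hence is nonzero. *)
Lemma dvdXn_exp1DX m d : (0 < d)%N -> 'X^(m.+1) %| ((1 + 'X) ^+ d - 1 : {poly k}) ->
  (m < d)%N.
Proof.
move=> d0 D; have s1 : size ((1 + 'X : {poly k}) ^+ d) = d.+1.
  by rewrite addrC -[1]opprK -polyC1 -polyCN size_exp_XsubC.
have s : size ((1 + 'X : {poly k}) ^+ d - 1) = d.+1.
  by rewrite size_polyDl ?s1 // size_polyN size_poly1 ltnS.
have : ((1 + 'X) ^+ d - 1 : {poly k}) != 0 by rewrite -size_poly_gt0 s.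
by move/dvdp_leq => /(_ _ D); rewrite size_polyXn s ltnS.
Qed.

Lemma graph_monomial_iso_loc m : curve_iso_loc (graph ('X^(m.+1) : {poly k}) 1) (tpoly k).
Proof.
apply: (graph_iso_loc (N := m) (u := 1) (v := 0)); rewrite ?polyX_eq0 //.
by rewrite mul0r addr0 mulr1.
Qed.

(** An affine change of x preserves the degree of the coefficient of y. *)
Lemma graph_equiv_size_exp q (b b' : {poly k}) m n : (1 < size q)%N -> (1 < n)%N ->
  (size b' <= (size q).-1 * n)%N ->
  curve_equiv (graph (q ^+ m) b) (graph (q ^+ n) b') -> m = n.
Proof.
move=> sq n1 sb'.
have q0 : q != 0 by rewrite -size_poly_gt0 ltnW.
have sX i : size (q ^+ i) = ((size q).-1 * i).+1.
  by rewrite -size_exp prednK // size_poly_gt0 expf_neq0.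
case/graph_rigid; rewrite ?expf_neq0 ?sX //.
  by rewrite ltnS; move: (size q) sq => N; nia.
move=> p [c [d [sp _ d0 Ep _]]].
have := size_comp_poly2 (q ^+ n) sp; rewrite Ep size_scale // !sX => -[/eqP].
by rewrite eqn_pmul2l => [/eqP|]; last by move: (size q) sq => N; lia.
Qed.

(** The constant terms of [cubeC] and [cubeD] are inverse to each other modulo q^3. *)
Definition cubeC q : {mpoly k[2]} := graph (q ^+ 3) (1 + q).
Definition cubeD q : {mpoly k[2]} := graph (q ^+ 3) (1 - q + q ^+ 2).

Lemma cube_bezout q : (1 + q) * (1 - q + q ^+ 2) = 1 + q ^+ 3 * 1.
Proof. ring. Qed.

Lemma cube_compl_iso q : q != 0 -> compl_iso (cubeC q) (cubeD q).
Proof. by move=> q0; apply: graph_compl_iso_inv (cube_bezout q); rewrite expf_neq0. Qed.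

Lemma cubeC_iso_loc q n : q != 0 -> curve_iso_loc (cubeC (q ^+ n.+1)) q.
Proof.
(* N + 1 = 3 (n + 1) is the exponent of q in the coefficient of y. *)
move=> q0; apply: (graph_iso_loc (N := (n * 3 + 2)%N)
  (u := 1 - q ^+ n.+1 + (q ^+ n.+1) ^+ 2) (v := - 1)) => //.
  by rewrite -exprM; congr (_ ^+ _); lia.
by rewrite mulrC cube_bezout; ring.
Qed.

Lemma cubeD_iso_loc q n : q != 0 -> curve_iso_loc (cubeD (q ^+ n.+1)) q.
Proof.
move=> q0; apply: (graph_iso_loc (N := (n * 3 + 2)%N)
  (u := 1 + q ^+ n.+1) (v := - 1)) => //.
  by rewrite -exprM; congr (_ ^+ _); lia.
by rewrite cube_bezout; ring.
Qed.

(* An equivalence would rescale q to t q for some t != 0, and 1 - t q + t^2 q^2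
   would be proportional to 1 + q modulo q^3. *)
Lemma cube_not_equiv q : (1 < size q)%N -> ~ curve_equiv (cubeC q) (cubeD q).
Proof.
move=> sq.
have q0 : q != 0 by rewrite -size_poly_gt0 ltnW.
have sX i : size (q ^+ i) = ((size q).-1 * i).+1.
  by rewrite -size_exp prednK // size_poly_gt0 expf_neq0.
case/graph_rigid; rewrite ?expf_neq0 ?sX //.
- by move: (size q) sq => N; nia.
- rewrite (leq_ltn_trans (size_polyD _ _)) // gtn_max sX; apply/andP; split; last first.
    by move: (size q) sq => N; nia.
  rewrite (leq_ltn_trans (size_polyD _ _)) // gtn_max size_polyN size_poly1.
  by move: (size q) sq => N; nia.
move=> p [c [d [sp c0 d0 Ep D]]].
(* Cancelling cubes in q(p)^3 = d q^3 shows that q divides q(p), which has the same degree. *)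
have : q %= q \Po p.
  rewrite -dvdp_size_eqp ?size_comp_poly2 //.
  by rewrite -(dvdp_pexp2r _ _ (isT : 0 < 3)%N) -rmorphXn /= Ep dvdpZr.
case/eqpP=> [[c1 c2] /= /andP[c10 c20] E].
have [t t0 Et] : exists2 t, t != 0 & q \Po p = t *: q.
  exists (c2^-1 * c1); first by rewrite mulf_neq0 ?invr_neq0.
  by rewrite -scalerA E scalerA mulVf // scale1r.
pose R : {poly k} := (1 - c)%:P - (t + c) *: 'X + t ^+ 2 *: 'X^2.
have ER : (1 - q + q ^+ 2) \Po p - c *: (1 + q) = R \Po q.
  rewrite /R !(comp_polyB, comp_polyD, comp_polyZ, comp_polyC) comp_polyX comp_Xn_poly.
  rewrite rmorph1 rmorphXn /= Et -!mul_polyC polyCB polyCD rmorphXn /=; ring.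
(* R(q) is a multiple of q^3 of degree at most 2 deg q, hence zero; its coefficient t^2 then
   contradicts t != 0. *)
have R0 : R \Po q == 0.
  apply: contraLR D => RQ0; rewrite ER; apply/negP => /(dvdp_leq RQ0).
  rewrite sX; have := size_comp_poly R q.
  have sR : (size R <= 3)%N.
    rewrite (leq_trans (size_polyD _ _)) // geq_max (leq_trans (size_scale_leq _ _)) ?size_polyXn // andbT.
    rewrite (leq_trans (size_polyD _ _)) // geq_max size_polyN (leq_trans (size_scale_leq _ _)) ?size_polyX // andbT.
    by rewrite (leq_trans (size_polyC_leq1 _)).
  by move: (size (R \Po q)) (size R) (size q) sR sq => x y z; nia.
move: R0; rewrite comp_poly_eq0 // => /eqP /(congr1 (fun P : {poly k} => P`_2)).
rewrite /R coefD coefB coefC !coefZ coefX coefXn coef0 /= !mulr0 mulr1 subrr add0r.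
by move/eqP; rewrite expf_eq0 (negPf t0).
Qed.

End CurveFamilies.

Theorem theorem2 (k : fieldType) :
  (* (1) *)
  ((exists f : {mpoly k[2]},
      [/\ closed_curve f, curve_iso_loc f (tpoly k) & inf_many_embs f]) /\
   (exists F : nat -> {mpoly k[2]},
      (forall i, [/\ closed_curve (F i), curve_iso_loc (F i) (tpoly k)
                   & inf_many_embs (F i)]) /\
      (forall i j, i <> j -> ~ curve_equiv (F i) (F j)))) /\
  (* (2) *)
  ((forall n : nat, (1 <= n)%N ->
      exists C : 'I_n -> {mpoly k[2]},
        [/\ (forall i, closed_curve (C i)),
            (forall i, curve_iso_loc (C i) (tpoly k)),
            (forall i j, i != j -> ~ curve_equiv (C i) (C j)) &
            (forall i j, compl_iso (C i) (C j))]) /\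
   ([pchar k] =i pred0 ->
      exists C : nat -> {mpoly k[2]},
        [/\ (forall i, closed_curve (C i)),
            (forall i j, i <> j -> ~ curve_equiv (C i) (C j)) &
            (forall i j, compl_iso (C i) (C j))])) /\
  (* (3) *)
  (forall q : {poly k}, (2 <= size q)%N ->
     (exists C D : {mpoly k[2]},
        [/\ closed_curve C /\ closed_curve D,
            curve_iso_loc C q /\ curve_iso_loc D q,
            ~ curve_equiv C D & compl_iso C D]) /\
     (exists C : nat -> {mpoly k[2]},
        (forall i, exists D : {mpoly k[2]},
           [/\ closed_curve (C i) /\ closed_curve D,
               curve_iso_loc (C i) q /\ curve_iso_loc D q,
               ~ curve_equiv (C i) D & compl_iso (C i) D]) /\
        (forall i j, i <> j -> ~ curve_equiv (C i) (C j)))).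
Proof.
have Xn0 n : 'X^n != 0 :> {poly k} by rewrite expf_neq0 ?polyX_eq0.
have sX : (1 < size ('X : {poly k}))%N by rewrite size_polyX.
have closedG (a b q : {poly k}) : a != 0 -> curve_iso_loc (graph a b) q ->
    closed_curve (graph a b).
  by move=> a0; apply: iso_loc_closed_curve; apply: graph_neq0.
have G1 i : [/\ closed_curve (graph ('X^(i.+2) : {poly k}) 1),
    curve_iso_loc (graph ('X^(i.+2) : {poly k}) 1) (tpoly k)
  & inf_many_embs (graph ('X^(i.+2) : {poly k}) 1)].
  split; [|exact: graph_monomial_iso_loc|exact: monomial_graph_inf_many_embs].
  exact: closedG (graph_monomial_iso_loc k i.+1).
have closedS m j : closed_curve (sheared_graph k m j).
  exact: closedG (sheared_graph_iso_loc k m j).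
split; last split.
- split; first by exists (graph 'X^2 1); apply: (G1 0%N).
  (* Exponents start at 2, where rigidity applies, and are recovered as degrees. *)
  exists (fun i => graph 'X^(i.+2) 1); split=> // i j ij E; apply: ij.
  suff [] : i.+2 = j.+2 by [].
  apply: (graph_equiv_size_exp sX _ _ E) => //.
  by rewrite size_poly1 size_polyX.
- split=> [n n1|pchar0].
    (* With m = n, an equivalence would require n < d, whereas d <= max(i, j) < n. *)
    exists (fun i : 'I_n => sheared_graph k n i); split=> [//|i|i j ij|i j].
    - exact: sheared_graph_iso_loc.
    - case/sheared_graph_equiv=> [/val_inj|d [/andP[d0 dn] D]].
        by apply/eqP.
      have := dvdXn_exp1DX d0 D; rewrite ltnNge => /negP; apply; apply: leq_trans dn _.
      by rewrite geq_max (ltnW (ltn_ord i)) (ltnW (ltn_ord j)).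
    - exact: sheared_graph_compl_iso.
  (* For m = 1 the obstruction is a congruence modulo x^2, whose linear coefficient d is nonzero in
     characteristic 0. *)
  exists (sheared_graph k 1); split=> [//|i j ij|i j]; last exact: sheared_graph_compl_iso.
  case/(sheared_graph_equiv ij)=> d [/andP[d0 _] /dvdXX[_]].
  rewrite -polyC1 derivB derivC subr0 deriv_exp derivD derivC derivX add0r.
  rewrite mul1r hornerMn horner_exp hornerD hornerC hornerX addr0 expr1n.
  by move/eqP; have /pcharf0P -> := pchar0; move=> /eqP dE; rewrite dE in d0.
- move=> q sq; have q0 : q != 0 by rewrite -size_poly_gt0 ltnW.
  have sQ n : (1 < size (q ^+ n.+1)%R)%N.
    rewrite -(prednK (_ : 0 < size (q ^+ n.+1)%R)%N) ?size_poly_gt0 ?expf_neq0 //.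
    by rewrite size_exp ltnS muln_gt0 andbT -subn1 subn_gt0.
  have pairQ n : [/\ closed_curve (cubeC (q ^+ n.+1)) /\ closed_curve (cubeD (q ^+ n.+1)),
      curve_iso_loc (cubeC (q ^+ n.+1)) q /\ curve_iso_loc (cubeD (q ^+ n.+1)) q,
      ~ curve_equiv (cubeC (q ^+ n.+1)) (cubeD (q ^+ n.+1)) &
      compl_iso (cubeC (q ^+ n.+1)) (cubeD (q ^+ n.+1))].
    have Q0 : (q ^+ n.+1) ^+ 3 != 0 by rewrite !expf_neq0.
    split.
    - by split; apply: (closedG _ _ q Q0); [exact: cubeC_iso_loc|exact: cubeD_iso_loc].
    - by split; [exact: cubeC_iso_loc|exact: cubeD_iso_loc].
    - exact: cube_not_equiv.
    - by apply: cube_compl_iso; rewrite expf_neq0.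
  split; first by exists (cubeC (q ^+ 1)), (cubeD (q ^+ 1)); apply: pairQ.
  (* Replacing q by its powers keeps the curve isomorphic to Spec k[t, 1/q] while changing the
     degree of the coefficient of y. *)
  exists (fun n => cubeC (q ^+ n.+1)); split=> [n|i j ij].
    by exists (cubeD (q ^+ n.+1)); apply: pairQ.
  rewrite /cubeC -!exprM => E; apply: ij.
  suff /eqP : (i.+1 * 3 = j.+1 * 3)%N by rewrite eqn_pmul2r // => /eqP[].
  apply: (graph_equiv_size_exp sq _ _ E) => //.
  rewrite (leq_trans (size_polyD _ _)) // geq_max size_poly1.
  have := size_exp q j.+1; move: (size q) (size (q ^+ j.+1)) sq => x y; nia.
Qed.
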